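(* Let $X$, $Y$ be Banach spaces and let $K$ be a compact Hausdorff space. If the pair $(X,Y)$ has the generalized AHSP and $\mathcal{L}(X,\mathcal{C}(K,Y)) = \mathcal{K}(X,\mathcal{C}(K,Y))$, then the pair $(X, \mathcal{C}(K,Y))$ has the generalized AHSP. Equivalently, if the pair $(\ell_1(X),Y)$ has the BPBp and $\mathcal{L}(X,\mathcal{C}(K,Y)) = \mathcal{K}(X,\mathcal{C}(K,Y))$, then the pair $(\ell_1(X), \mathcal{C}(K,Y))$ has the BPBp.
   Context: Banach spaces are real or complex (all over the same scalar field). For a Banach space $X$, $B_X$ is the closed unit ball, $S_X$ the unit sphere, $X^*$ the topological dual. $\mathcal{L}(X,Y)$ is the Banach space of bounded linear operators from $X$ into $Y$ with the operator norm, and $\mathcal{K}(X,Y)$ is the subspace of compact operators, i.e. those $T$ for which $\overline{T(B_X)}$ is compact in $Y$. $\ell_1(X)$ is the Banach space of all sequences $(x_k)$ in $X$ with $\sum_{k=1}^\infty \|x_k\|$ convergent, normed by this sum. $\mathcal{C}(K,Y)$ is the Banach space of all continuous functions from $K$ into $Y$ with the supremum norm. A convex series $\sum_{k=1}^\infty \alpha_k$ is a series with $\alpha_k \ge 0$ and $\sum_{k=1}^\infty \alpha_k = 1$. BPBp: a pair $(X,Y)$ of Banach spaces has the Bishop-Phelps-Bollobás property for operators (BPBp) if, given $\varepsilon>0$, there is $\eta(\varepsilon)>0$ such that for every $T\in S_{\mathcal{L}(X,Y)}$ and $x_0\in S_X$ with $\|Tx_0\|>1-\eta(\varepsilon)$,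 there exist $S\in S_{\mathcal{L}(X,Y)}$ and $u_0\in S_X$ such that $\|Su_0\|=1$, $\|u_0-x_0\|<\varepsilon$ and $\|S-T\|<\varepsilon$. Generalized AHSP: a pair $(X,Y)$ of Banach spaces has the generalized approximate hyperplane series property (generalized AHSP) if, for every $\varepsilon>0$, there exists $0<\eta(\varepsilon)<\varepsilon$ such that given sequences $(T_k)\subset S_{\mathcal{L}(X,Y)}$ and $(x_k)\subset S_X$, and a convex series $\sum_{k=1}^\infty\alpha_k$ such that $\left\|\sum_{k=1}^\infty \alpha_k T_k x_k\right\|>1-\eta(\varepsilon)$, there exist a subset $A\subset\mathbb{N}$, $y^*\in S_{Y^*}$, and sequences $(S_k)\subset S_{\mathcal{L}(X,Y)}$, $(z_k)\subset S_X$ satisfying: (1) $\sum_{k\in A}\alpha_k>1-\varepsilon$; (2) $\|z_k-x_k\|<\varepsilon$ and $\|S_k-T_k\|<\varepsilon$ for all $k\in A$; (3) $y^*(S_kz_k)=1$ for every $k\in A$. *)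

(* Defs.v *)
From HB Require Import structures.
From mathcomp Require Import all_boot all_order all_algebra.
From mathcomp Require Import all_classical all_reals all_analysis.
From mathcomp Require Import complex.

Set Implicit Arguments.
Unset Strict Implicit.
Unset Printing Implicit Defensive.

Import Order.TTheory GRing.Theory Num.Theory.
Import numFieldNormedType.Exports.

Local Open Scope classical_set_scope.
Local Open Scope ring_scope.

Variant scalar_kind := RealScalars | ComplexScalars.

Definition scalars (R : realType) (s : scalar_kind) : numFieldType :=
  match s with RealScalars => R | ComplexScalars => R[i] end.

Definition scalar_re (R : realType) (s : scalar_kind) : scalars R s -> R :=
  match s with RealScalars => id | ComplexScalars => @complex.Re R end.

Definition scalar_of_real (R : realType) (s : scalar_kind) : R -> scalars R s :=
  match s with RealScalars => id | ComplexScalars => fun r => Complex r 0 end.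

Arguments scalar_re {R s}.
Arguments scalar_of_real {R s}.

Section scalar_theory.
Context {R : realType} {s : scalar_kind}.
Local Notation F := (scalars R s).
Implicit Types (r : R) (a b : F).

Lemma scalar_of_realK r : scalar_re (scalar_of_real r : F) = r.
Proof. by case: s. Qed.

Lemma scalar_reK a : 0 <= a -> scalar_of_real (scalar_re a) = a.
Proof.
case: s a => //= -[x y]; rewrite lecE /= => /andP[/eqP y0 _].
by congr Complex; rewrite y0.
Qed.

Lemma scalar_reD a b : scalar_re (a + b) = scalar_re a + scalar_re b.
Proof. by case: s a b => //= -[x y] [z t]. Qed.

Lemma scalar_reM a b : 0 <= a ->
  scalar_re (a * b) = scalar_re a * scalar_re b.
Proof.
case: s a b => //= -[x y] [z t]; rewrite lecE /= => /andP[/eqP -> _].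
by rewrite mul0r subr0.
Qed.

Lemma le_scalar_re a b : a <= b -> scalar_re a <= scalar_re b.
Proof. by case: s a b => //= a b; rewrite lecE => /andP[]. Qed.

Lemma scalar_of_realD r t :
  scalar_of_real (r + t) = scalar_of_real r + scalar_of_real t :> F.
Proof. by case: s => //=; apply/eqP; rewrite eq_complex/= addr0 !eqxx. Qed.

Lemma scalar_of_realM r t :
  scalar_of_real (r * t) = scalar_of_real r * scalar_of_real t :> F.
Proof.
case: s => //=; apply/eqP; rewrite eq_complex/=.
by rewrite !(mulr0, mul0r) subr0 addr0 !eqxx.
Qed.

Lemma le_scalar_of_real r t :
  ((scalar_of_real r : F) <= scalar_of_real t) = (r <= t).
Proof. by case: s => //=; rewrite lecE/= eqxx. Qed.

Lemma lt_scalar_of_real r t :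
  ((scalar_of_real r : F) < scalar_of_real t) = (r < t).
Proof. by case: s => //=; rewrite ltcE/= eqxx. Qed.

Lemma scalar_of_real0 : scalar_of_real 0 = 0 :> F.
Proof. by case: s. Qed.

Lemma scalar_re0 : scalar_re (0 : F) = 0.
Proof. by case: s. Qed.

Lemma scalar_re1 : scalar_re (1 : F) = 1.
Proof. by case: s. Qed.

End scalar_theory.

(* The library's norm on a normed module over F takes its values in F, hence in
   R[i] in the complex case; rnorm is the same norm with values in R. *)
Definition rnorm {R : realType} {s : scalar_kind}
    {V : normedModType (scalars R s)} (x : V) : R := scalar_re `|x|.

Section rnorm_theory.
Context {R : realType} {s : scalar_kind} {V : normedModType (scalars R s)}.
Local Notation F := (scalars R s).
Implicit Types (x y : V).

Lemma rnormE x : scalar_of_real (rnorm x) = `|x|.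
Proof. by rewrite scalar_reK. Qed.

Lemma rnorm_ge0 x : 0 <= rnorm x.
Proof. by rewrite -(@scalar_re0 R s) le_scalar_re. Qed.

Lemma rnorm0 : rnorm (0 : V) = 0.
Proof. by rewrite /rnorm normr0 scalar_re0. Qed.

Lemma rnorm_eq0 x : rnorm x = 0 -> x = 0.
Proof. by move=> x0; apply/normr0_eq0; rewrite -rnormE x0 scalar_of_real0. Qed.

Lemma ler_rnormD x y : rnorm (x + y) <= rnorm x + rnorm y.
Proof. by rewrite -scalar_reD le_scalar_re// ler_normD. Qed.

Lemma rnormZ (a : F) x : rnorm (a *: x) = scalar_re `|a| * rnorm x.
Proof. by rewrite /rnorm normrZ scalar_reM. Qed.

Lemma rnormB x y : rnorm (x - y) = rnorm (y - x).
Proof. by rewrite /rnorm distrC. Qed.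

Lemma rnorm_lt x (e : F) : 0 <= e -> (`|x| < e) = (rnorm x < scalar_re e).
Proof. by move=> e0; rewrite -rnormE -{1}(scalar_reK e0) lt_scalar_of_real. Qed.

Lemma rnorm_dist x y : `|rnorm x - rnorm y| <= rnorm (x - y).
Proof.
rewrite ler_distl lerBlDr; apply/andP; split.
  by have := ler_rnormD (y - x) x; rewrite subrK rnormB addrC.
by have := ler_rnormD (x - y) y; rewrite subrK addrC.
Qed.

Lemma cvg_rnormP (T : Type) (G : set_system T) (f : T -> V) (l : V) :
  Filter G ->
  f @ G --> l <-> forall e : R, 0 < e -> \forall t \near G, rnorm (l - f t) < e.
Proof.
move=> FG; split=> [/cvgrPdist_lt fl e e0|fl].
  have := fl (scalar_of_real e).
  rewrite -(@scalar_of_real0 R s) lt_scalar_of_real => /(_ e0).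
  apply: filterS => t; rewrite rnorm_lt ?scalar_of_realK//.
  by rewrite -scalar_of_real0 le_scalar_of_real ltW.
apply/cvgrPdist_lt => e e0.
have := fl (scalar_re e).
rewrite -(@lt_scalar_of_real R s) scalar_of_real0 scalar_reK ?(ltW e0)//.
by move=> /(_ e0); apply: filterS => t; rewrite rnorm_lt// ltW.
Qed.

Lemma cvg_rnorm (T : Type) (G : set_system T) (f : T -> V) (l : V) :
  Filter G -> f @ G --> l -> (fun t => rnorm (f t)) @ G --> rnorm l.
Proof.
move=> FG /cvg_rnormP fl; apply/cvgrPdist_lt => e e0.
by apply: filterS (fl e e0) => t; apply: le_lt_trans (rnorm_dist _ _).
Qed.

Lemma cauchy_rnormP (G : set_system V) : Filter G ->
  cauchy G <-> forall e : R, 0 < e -> \forall x & y \near G, rnorm (x - y) < e.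
Proof.
move=> FG; rewrite -cauchy_ballP; split=> h e e0.
  have := h (scalar_of_real e).
  rewrite -(@scalar_of_real0 R s) lt_scalar_of_real => /(_ e0).
  apply: filterS => -[x y]; rewrite -ball_normE /= rnorm_lt ?scalar_of_realK//.
  by rewrite -scalar_of_real0 le_scalar_of_real ltW.
have := h (scalar_re e).
rewrite -(@lt_scalar_of_real R s) scalar_of_real0 scalar_reK ?(ltW e0)//.
move=> /(_ e0); apply: filterS => -[x y].
by rewrite -ball_normE /= rnorm_lt// ltW.
Qed.

End rnorm_theory.

Section l1.
Context {R : realType} {s : scalar_kind} (X : completeNormedModType (scalars R s)).
Local Notation F := (scalars R s).

Definition summable : {pred nat -> X} :=
  [pred x | `[< cvgn (series (fun k => rnorm (x k))) >] ].

Record l1 := L1 { l1_seq :> nat -> X; l1_summable : l1_seq \in summable }.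

HB.instance Definition _ := [isSub for l1_seq].
HB.instance Definition _ := [Choice of l1 by <:].

Lemma summableP (x : nat -> X) :
  reflect (exists M : R, forall n, \sum_(0 <= k < n) rnorm (x k) <= M)
          (x \in summable).
Proof.
apply: (iffP (asboolP _)) => [cx|[M xM]].
  exists (limn (series (fun k => rnorm (x k)))) => n.
  apply: (nondecreasing_cvgn_le _ cx n).
  by apply: nondecreasing_series => k _ _; exact: rnorm_ge0.
apply: nondecreasing_is_cvgn.
  by apply: nondecreasing_series => k _ _; exact: rnorm_ge0.
by exists M => _ [n _ <-]; exact: xM.
Qed.

Lemma summable_submod : submod_closed summable.
Proof.
split=> [|a x y /summableP[M xM] /summableP[N yN]].
  by apply/summableP; exists 0 => n; rewrite big1// => k _; rewrite rnorm0.
apply/summableP; exists (scalar_re `|a| * M + N) => n.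
apply: le_trans (_ : \sum_(0 <= k < n)
  (scalar_re `|a| * rnorm (x k) + rnorm (y k)) <= _).
  by apply: ler_sum => k _; rewrite -rnormZ; exact: ler_rnormD.
rewrite big_split/=; apply: lerD; last exact: yN.
rewrite -mulr_sumr ler_wpM2l//.
by rewrite -(@scalar_re0 R s) le_scalar_re.
Qed.

HB.instance Definition _ :=
  GRing.isSubmodClosed.Build F (nat -> X) summable summable_submod.
HB.instance Definition _ := [SubChoice_isSubLmodule of l1 by <:].

Definition l1_rnorm (x : l1) : R := limn (series (fun k => rnorm (x k))).

Lemma l1_cvg (x : l1) : cvgn (series (fun k => rnorm (x k))).
Proof. exact/asboolP/l1_summable. Qed.

Lemma sum_le_l1_rnorm (x : l1) n : \sum_(0 <= k < n) rnorm (x k) <= l1_rnorm x.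
Proof.
apply: (nondecreasing_cvgn_le (u_ := series (fun k => rnorm (x k)))).
  by apply: nondecreasing_series => k _ _; exact: rnorm_ge0.
exact: l1_cvg.
Qed.

Lemma l1_rnorm_le (x : l1) (M : R) :
  (forall n, \sum_(0 <= k < n) rnorm (x k) <= M) -> l1_rnorm x <= M.
Proof. by move=> xM; apply: limr_le; [exact: l1_cvg|exact: nearW]. Qed.

Lemma rnorm_le_l1_rnorm (x : l1) k : rnorm (x k) <= l1_rnorm x.
Proof.
apply: le_trans (sum_le_l1_rnorm x k.+1); rewrite big_nat_recr//=.
by rewrite lerDr sumr_ge0// => i _; exact: rnorm_ge0.
Qed.

Definition l1_norm (x : l1) : F := scalar_of_real (l1_rnorm x).

Let l1_ler_normD x y : l1_norm (x + y) <= l1_norm x + l1_norm y.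
Proof.
rewrite -scalar_of_realD le_scalar_of_real; apply: l1_rnorm_le => n.
apply: le_trans (_ : \sum_(0 <= k < n) (rnorm (x k) + rnorm (y k)) <= _).
  by apply: ler_sum => k _; exact: ler_rnormD.
by rewrite big_split lerD ?sum_le_l1_rnorm.
Qed.

Let l1_normrZ (a : F) x : l1_norm (a *: x) = `|a| * l1_norm x.
Proof.
rewrite -{1}(scalar_reK (normr_ge0 a)) -scalar_of_realM; congr scalar_of_real.
have cZ : (scalar_re `|a| *: series (fun k => rnorm (x k)) : R^nat) @ \oo -->
    scalar_re `|a| * l1_rnorm x.
  by apply: cvgZl_tmp; exact: l1_cvg.
rewrite -(cvg_lim _ cZ)//; congr (lim (_ @ \oo)); apply/funext => n.
transitivity (scalar_re `|a| * \sum_(0 <= k < n) rnorm (x k)) => //.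
rewrite mulr_sumr.
by apply: eq_bigr => k _; rewrite -rnormZ.
Qed.

Let l1_normr0_eq0 x : l1_norm x = 0 -> x = 0.
Proof.
move=> /(congr1 scalar_re); rewrite scalar_of_realK scalar_re0 => x0.
apply/val_inj/funext => k; apply: rnorm_eq0; apply/le_anti.
by rewrite rnorm_ge0 andbT -x0 rnorm_le_l1_rnorm.
Qed.

HB.instance Definition _ :=
  Lmodule_isNormed.Build F l1 l1_ler_normD l1_normrZ l1_normr0_eq0.

Lemma rnorm_l1E (x : l1) : rnorm x = limn (series (fun k => rnorm (x k))).
Proof. exact: scalar_of_realK. Qed.

Let l1_complete (G : set_system l1) : ProperFilter G -> cauchy G -> cvg G.
Proof.
move=> FG /cauchy_rnormP cG.
have Gk k : cvg ((fun x : l1 => x k) @ G).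
  apply: cauchy_cvg; apply/cauchy_rnormP => e e0.
  have [[A B] [/= GA GB] AB] := cG e e0.
  exists ((fun x : nat -> X => x k) @` (l1_seq @` A),
          (fun x : nat -> X => x k) @` (l1_seq @` B)).
    split; [apply: filterS GA => x Ax|apply: filterS GB => x Bx];
      by exists (x : nat -> X) => //; exists x.
  move=> [_ _] [/= [_ [x Ax <-] <-]] [_ [y By <-] <-].
  apply: le_lt_trans (AB (x, y) _) => //.
  by rewrite [leRHS]scalar_of_realK; exact: (rnorm_le_l1_rnorm (x - y)).
pose l k : X := lim ((fun x : l1 => x k) @ G).
have Gl (e : R) : 0 < e -> \forall x \near (G : set_system l1), forall n,
    \sum_(0 <= k < n) rnorm ((x : l1) k - l k) <= e.
  move=> e0; have [[A B] [/= GA GB] AB] := cG e e0.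
  apply: filterS GA => x Ax n.
  apply: (@cvgr_to_le l1 G FG R (fun y : l1 => \sum_(0 <= k < n) rnorm (x k - y k))).
    apply: cvg_big => [|k _]; first exact: add_continuous.
    apply: cvg_rnorm.
    by apply: cvgB; [exact: cvg_cst|exact: Gk].
  apply: filterS GB => y By; apply: ltW; apply: le_lt_trans (AB (x, y) _) => //.
  by rewrite [leRHS]scalar_of_realK; exact: (sum_le_l1_rnorm (x - y)).
have sl : l \in summable.
  have [x xl] := filter_ex (Gl 1 ltr01).
  rewrite (_ : l = (-1 : F) *: (fun k => x k - l k) + x); last first.
    by apply/funext => k /=; rewrite /GRing.scale/= /GRing.add/= scaleN1r opprB subrK.
  apply: (proj2 summable_submod); last exact: l1_summable.
  by apply/summableP; exists 1.
apply/cvg_ex; exists (L1 sl); apply/(@cvg_rnormP _ _ _ _ G id) => e e0.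
have e20 : 0 < e / 2 by rewrite divr_gt0.
apply: filterS (Gl _ e20) => x xl; rewrite rnormB.
apply: le_lt_trans (_ : e / 2 < e); last by rewrite ltr_pdivrMr// ltr_pMr// ltr1n.
by rewrite [leLHS]scalar_of_realK; apply: l1_rnorm_le => n; exact: xl.
Qed.

HB.instance Definition _ := Uniform_isComplete.Build l1 l1_complete.

End l1.

Definition continuous_pred {K : topologicalType} {R : realType}
    {s : scalar_kind} {Y : completeNormedModType (scalars R s)} : {pred K -> Y} :=
  [pred f | `[< continuous f >] ].

(* The proof cK is a parameter of the type because the norm instance below
   needs it: the supremum norm is finite thanks to compactness. *)
Record cfun {R : realType} {s : scalar_kind} {K : topologicalType}
    (cK : compact [set: K]) (Y : completeNormedModType (scalars R s)) :=
  CFun { cfun_fun :> K -> Y; cfun_continuous : cfun_fun \in continuous_pred }.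

Section cfun.
Context {R : realType} {s : scalar_kind} {K : topologicalType}.
Context (cK : compact [set: K]) (Y : completeNormedModType (scalars R s)).
Local Notation F := (scalars R s).
Local Notation cfun := (cfun cK Y).
Local Notation cfun_fun := (@cfun_fun R s K cK Y).
Local Notation CFun := (@CFun R s K cK Y _).
Local Notation continuous_pred := (continuous_pred : {pred K -> Y}).

HB.instance Definition _ := [isSub for cfun_fun].
HB.instance Definition _ := [Choice of cfun by <:].

Lemma continuous_submod : submod_closed continuous_pred.
Proof.
split=> [|a f g /asboolP cf /asboolP cg].
  by apply/asboolP => t; exact: cvg_cst.
apply/asboolP => t; apply: cvgD; last exact: cg.
by apply: cvgZl_tmp; exact: cf.
Qed.

HB.instance Definition _ :=
  GRing.isSubmodClosed.Build F (K -> Y) continuous_pred continuous_submod.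
HB.instance Definition _ := [SubChoice_isSubLmodule of cfun by <:].

Definition cfun_rnorm (f : cfun) : R := sup [set rnorm (f t) | t in [set: K]].

Definition cfun_norm (f : cfun) : F := scalar_of_real (cfun_rnorm f).

Lemma cfunP (f : cfun) : continuous f.
Proof. exact/asboolP/cfun_continuous. Qed.

Lemma cfun_ubound (f : cfun) : has_ubound [set rnorm (f t) | t in [set: K]].
Proof.
have : compact ((fun t => rnorm (f t)) @` [set: K]).
  apply: continuous_compact => //; apply/continuous_subspaceT => t.
  by apply: cvg_rnorm; exact: cfunP.
move=> /compact_bounded[M [_ fM]]; exists (M + 1) => r fr.
by apply: le_trans (ler_norm r) _; apply: fM => //; rewrite ltrDl.
Qed.

Lemma rnorm_le_cfun_rnorm (f : cfun) t : rnorm (f t) <= cfun_rnorm f.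
Proof. by apply: ub_le_sup; [exact: cfun_ubound|exists t]. Qed.

Lemma cfun_rnorm_ge0 (f : cfun) : 0 <= cfun_rnorm f.
Proof.
rewrite /cfun_rnorm; have [E|/set0P[_ [t _ _]]] :=
  eqVneq [set rnorm (f t) | t in [set: K]] set0; first by rewrite E sup0.
by apply: le_trans (rnorm_ge0 (f t)) _; exact: rnorm_le_cfun_rnorm.
Qed.

Lemma cfun_rnorm_le (f : cfun) (M : R) :
  0 <= M -> (forall t, rnorm (f t) <= M) -> cfun_rnorm f <= M.
Proof.
move=> M0 fM; rewrite /cfun_rnorm; have [E|/set0P ne] :=
  eqVneq [set rnorm (f t) | t in [set: K]] set0; first by rewrite E sup0.
by apply: ge_sup => // _ [t _ <-].
Qed.

Let cfun_ler_normD f g : cfun_norm (f + g) <= cfun_norm f + cfun_norm g.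
Proof.
rewrite -scalar_of_realD le_scalar_of_real; apply: cfun_rnorm_le => [|t].
  by rewrite addr_ge0 ?cfun_rnorm_ge0.
by apply: le_trans (ler_rnormD _ _) _; rewrite lerD ?rnorm_le_cfun_rnorm.
Qed.

Let cfun_rnormZ_le (a : F) f :
  cfun_rnorm (a *: f) <= scalar_re `|a| * cfun_rnorm f.
Proof.
have a0 : 0 <= scalar_re `|a| by rewrite -(@scalar_re0 R s) le_scalar_re.
apply: cfun_rnorm_le => [|t]; first by rewrite mulr_ge0// cfun_rnorm_ge0.
by rewrite (rnormZ a (f t)) ler_wpM2l// rnorm_le_cfun_rnorm.
Qed.

Let cfun_normrZ (a : F) f : cfun_norm (a *: f) = `|a| * cfun_norm f.
Proof.
rewrite -{1}(scalar_reK (normr_ge0 a)) -scalar_of_realM; congr scalar_of_real.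
have [->|a0] := eqVneq a 0.
  rewrite scale0r normr0 scalar_re0 mul0r; apply/le_anti.
  rewrite cfun_rnorm_ge0 andbT; apply: cfun_rnorm_le => // t.
  by rewrite [X in rnorm X](_ : _ = 0)// rnorm0.
apply/le_anti; rewrite cfun_rnormZ_le/=.
have := cfun_rnormZ_le a^-1 (a *: f); rewrite scalerA mulVf// scale1r.
move=> /(ler_wpM2l (x := scalar_re `|a|)).
rewrite mulrA -scalar_reM// -normrM divff// normr1.
rewrite scalar_re1 mul1r; apply.
by rewrite -(@scalar_re0 R s) le_scalar_re.
Qed.

Let cfun_normr0_eq0 f : cfun_norm f = 0 -> f = 0.
Proof.
move=> /(congr1 scalar_re); rewrite scalar_of_realK scalar_re0 => f0.
apply/val_inj/funext => t; apply: rnorm_eq0; apply/le_anti.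
by rewrite rnorm_ge0 andbT -f0 rnorm_le_cfun_rnorm.
Qed.

HB.instance Definition _ :=
  Lmodule_isNormed.Build F cfun cfun_ler_normD cfun_normrZ cfun_normr0_eq0.

Lemma rnorm_cfunE (f : cfun) :
  rnorm f = sup [set rnorm (f t) | t in [set: K]].
Proof. exact: scalar_of_realK. Qed.

Let cfun_complete (G : set_system cfun) : ProperFilter G -> cauchy G -> cvg G.
Proof.
move=> FG /cauchy_rnormP cG.
have Gt t : cvg ((fun f : cfun => f t) @ G).
  apply: cauchy_cvg; apply/cauchy_rnormP => e e0.
  have [[A B] [/= GA GB] AB] := cG e e0.
  exists ((fun f : K -> Y => f t) @` (cfun_fun @` A),
          (fun f : K -> Y => f t) @` (cfun_fun @` B)).
    split; [apply: filterS GA => f Af|apply: filterS GB => f Bf];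
      by exists (f : K -> Y) => //; exists f.
  move=> [_ _] [/= [_ [f Af <-] <-]] [_ [g Bg <-] <-].
  apply: le_lt_trans (AB (f, g) _) => //.
  by rewrite [leRHS]scalar_of_realK; exact: (rnorm_le_cfun_rnorm (f - g)).
pose l t : Y := lim ((fun f : cfun => f t) @ G).
have Gl (e : R) : 0 < e ->
    \forall f \near (G : set_system cfun), forall t, rnorm ((f : cfun) t - l t) <= e.
  move=> e0; have [[A B] [/= GA GB] AB] := cG e e0.
  apply: filterS GA => f Af t.
  apply: (@cvgr_to_le cfun G FG R (fun g : cfun => rnorm (f t - g t))).
    apply: cvg_rnorm.
    by apply: cvgB; [exact: cvg_cst|exact: Gt].
  apply: filterS GB => g Bg; apply: ltW; apply: le_lt_trans (AB (f, g) _) => //.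
  by rewrite [leRHS]scalar_of_realK; exact: (rnorm_le_cfun_rnorm (f - g)).
have cl : l \in continuous_pred.
  apply/asboolP => t; apply/cvg_rnormP => e e0.
  have e30 : 0 < e / 3 by rewrite divr_gt0.
  have [f fl] := filter_ex (Gl _ e30).
  have /cvg_rnormP /(_ _ e30) := @cfunP f t.
  apply: filterS => u ftu.
  rewrite (_ : l t - l u = (l t - f t) + ((f t - f u) + (f u - l u))); last first.
    by rewrite [_ + (_ - l u)]addrA subrK addrA subrK.
  rewrite (_ : e = e / 3 + (e / 3 + e / 3)); last first.
    by rewrite -!mulrDl -mulr2n -mulrS -(mulr_natr e 3) mulfK.
  apply: le_lt_trans (ler_rnormD _ _) _; apply: ler_ltD; first by rewrite rnormB.
  by apply: le_lt_trans (ler_rnormD _ _) _; apply: ltr_leD.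
apply/cvg_ex; exists (CFun cl); apply/(@cvg_rnormP _ _ _ _ G id) => e e0.
have e20 : 0 < e / 2 by rewrite divr_gt0.
apply: filterS (Gl _ e20) => f fl; rewrite rnormB.
apply: le_lt_trans (_ : e / 2 < e); last by rewrite ltr_pdivrMr// ltr_pMr// ltr1n.
rewrite [leLHS]scalar_of_realK; apply: cfun_rnorm_le; first exact: ltW.
by move=> t; exact: fl.
Qed.

HB.instance Definition _ := Uniform_isComplete.Build cfun cfun_complete.

End cfun.

Section operators.
Context {R : realType} {s : scalar_kind}.
Local Notation F := (scalars R s).

Definition unit_ball (X : normedModType F) : set X := [set x | rnorm x <= 1].

Definition unit_sphere (X : normedModType F) : set X := [set x | rnorm x = 1].

Arguments unit_ball : clear implicits.
Arguments unit_sphere : clear implicits.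

(* Meaningful for continuous linear T only: sup is 0 on unbounded sets. *)
Definition opnorm {X Y : normedModType F} (T : X -> Y) : R :=
  sup [set rnorm (T x) | x in unit_ball X].

Definition bounded_operators (X Y : normedModType F) : set {linear X -> Y} :=
  [set T : {linear X -> Y} | continuous T].

Arguments bounded_operators : clear implicits.

Definition operator_sphere (X Y : normedModType F) : set {linear X -> Y} :=
  [set T : {linear X -> Y} | bounded_operators X Y T /\ opnorm T = 1].

Arguments operator_sphere : clear implicits.

Definition compact_operators (X Y : normedModType F) : set {linear X -> Y} :=
  [set T : {linear X -> Y} | bounded_operators X Y T /\
     compact (closure (T @` unit_ball X))].

Definition convex_series (alpha : nat -> R) : Prop :=
  (forall k, 0 <= alpha k) /\ series alpha @ \oo --> (1 : R).

Definition BPBp (X Y : completeNormedModType F) : Prop :=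
  forall eps : R, 0 < eps ->
  exists2 eta : R, 0 < eta &
  forall (T : {linear X -> Y}) (x0 : X),
    operator_sphere X Y T -> unit_sphere X x0 -> 1 - eta < rnorm (T x0) ->
    exists (S : {linear X -> Y}) (u0 : X),
      [/\ operator_sphere X Y S, unit_sphere X u0, rnorm (S u0) = 1,
          rnorm (u0 - x0) < eps & opnorm (S \- T) < eps].

Definition generalized_AHSP (X Y : completeNormedModType F) : Prop :=
  forall eps : R, 0 < eps ->
  exists2 eta : R, 0 < eta < eps &
  forall (T : nat -> {linear X -> Y}) (x : nat -> X) (alpha : nat -> R),
    (forall k, operator_sphere X Y (T k)) -> (forall k, unit_sphere X (x k)) ->
    convex_series alpha ->
    1 - eta <
      rnorm (limn (series (fun k => scalar_of_real (alpha k) *: T k (x k)))) ->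
    exists (A : set nat) (ystar : {linear Y -> F^o})
           (S : nat -> {linear X -> Y}) (z : nat -> X),
      [/\ operator_sphere Y F^o ystar,
          forall k, operator_sphere X Y (S k) /\ unit_sphere X (z k),
          ((1 - eps)%:E < \esum_(k in A) (alpha k)%:E)%E,
          forall k, A k -> rnorm (z k - x k) < eps /\ opnorm (S k \- T k) < eps &
          forall k, A k -> ystar (S k (z k)) = 1].

End operators.

Arguments unit_ball {R s} X _.
Arguments unit_sphere {R s} X _.
Arguments bounded_operators {R s} X Y _.
Arguments operator_sphere {R s} X Y _.
Arguments compact_operators {R s} X Y _.

(* Main.v *)
Require Import Defs.
From HB Require Import structures.
From mathcomp Require Import all_boot all_order all_algebra.
From mathcomp Require Import all_classical all_reals all_analysis.
From mathcomp Require Import complex ring lra.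
Import Order.TTheory GRing.Theory Num.Theory.
Import numFieldNormedType.Exports.
Local Open Scope classical_set_scope.
Local Open Scope ring_scope.

Set Implicit Arguments.
Unset Strict Implicit.
Unset Printing Implicit Defensive.

(** Both halves rest on one localization argument.

Let [T : E -> C(K, Y)] have norm 1 and almost attain it at [x0]. The supremum
norm of [T x0] is almost reached at a point [t0] of [K], so the evaluated
operator [H x = T x t0] from [E] to [Y] almost attains a norm close to 1. After
moving [H] onto the unit sphere ([exists_sphere_near]), the property assumed
for [Y] yields a nearby operator [G : E -> Y] that attains its norm at a point
[z] near [x0]. It remains to put [G] back into [T] at [t0]: with a Urysohn
function [phi] equal to 1 at [t0] and supported in a small neighbourhood,
[S x t = (1 - phi t) T x t + phi t G x] is a pointwise convex combination of
contractions, hence a contraction; at [t0] it is [G], so it attains norm 1 at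
[z]; and [S - T = phi (G - T)] is small as soon as [T x t] is close to
[T x t0] on the support of [phi], uniformly for [x] in the unit ball. This
uniformity is equicontinuity of the image of the ball, i.e. compactness of [T]
([compact_operator_equicontinuous]), and is where the hypothesis on
[L(X, C(K, Y))] enters.

For the generalized AHSP the argument is applied to each [T k] separately, at a
common point [t0] chosen for the whole convex series. The evaluated operators
may be far from the unit sphere for some [k], but [convex_series_slack] shows
that the average of [1 - opnorm (H k)] is small, and a Chebyshev estimate
([esum_small_deficit]) lets those [k] be dropped from the index set.

For the BPBp an operator [T] on [l1 X] need not be compact, only its
coordinates are. Therefore [T] is modified on the first [N] coordinates only:
the truncation [P] is an L-projection, that is,
[rnorm x = rnorm (P x) + rnorm (x - P x)], which is what keeps the modified
operator a contraction ([localized_perturbation]). An operator attaining its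
norm at [u] also attains it at [P u] ([attains_Lprojection]), so [u] can be
replaced by the normalization of [P u], which is close to [u] when [N] is
large. *)

(** * Real scalars and real-valued norms *)

Section real_scalars.
Context {R : realType} {s : scalar_kind}.
Local Notation F := (scalars R s).
Implicit Types V : normedModType F.

Lemma scalar_of_real1 : scalar_of_real 1 = 1 :> F.
Proof. by case: s. Qed.

Lemma scalar_of_realB (r t : R) :
  scalar_of_real (r - t) = scalar_of_real r - scalar_of_real t :> F.
Proof. by apply/eqP; rewrite eq_sym subr_eq -scalar_of_realD subrK. Qed.

Lemma scalar_re_norm_of_real (r : R) :
  scalar_re `|scalar_of_real r : F| = `|r|.
Proof.
wlog r0 : r / 0 <= r => [H|].
  have [/H//|/ltW r0] := leP 0 r.
  rewrite -normrN -[in RHS]normrN -H ?oppr_ge0// -[- r]add0r scalar_of_realB.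
  by rewrite scalar_of_real0 add0r.
rewrite !ger0_norm ?scalar_of_realK// -scalar_of_real0.
by rewrite le_scalar_of_real.
Qed.

Lemma rnormZr V (r : R) (x : V) : rnorm (scalar_of_real r *: x) = `|r| * rnorm x.
Proof. by rewrite rnormZ scalar_re_norm_of_real. Qed.

Lemma ler_rnormB V (x y : V) : rnorm (x - y) <= rnorm x + rnorm y.
Proof. by have := ler_rnormD x (0 - y); rewrite (rnormB 0) subr0 sub0r. Qed.

Lemma rnorm_le_dist V (x y : V) : rnorm x <= rnorm y + rnorm (x - y).
Proof. by rewrite -{1}(subrK y x) addrC ler_rnormD. Qed.

Lemma scalar_of_real_continuous :
  continuous (scalar_of_real : R -> (F^o : normedModType F)).
Proof.
move=> r; apply/cvg_rnormP => e e0; near=> t.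
have -> : rnorm ((scalar_of_real r : F^o) - scalar_of_real t) = `|r - t|.
  by rewrite -scalar_re_norm_of_real scalar_of_realB.
by near: t; exact: cvgr_dist_lt.
Unshelve. all: by end_near. Qed.

Lemma rnorm_cvg_series (V : completeNormedModType F) (u : nat -> V) :
  cvgn (series (fun k => rnorm (u k))) -> cvgn (series u).
Proof.
move=> cu; apply: cauchy_cvg; apply/cauchy_seriesP => e e0.
have cc : cauchy (series (fun k => rnorm (u k)) @ \oo) by exact: cvg_cauchy.
have := (cauchy_seriesP _).1 cc (scalar_re e).
rewrite -(@lt_scalar_of_real R s) scalar_of_real0 scalar_reK ?(ltW e0)//.
move=> /(_ e0); apply: filterS => -[m n] /=.
rewrite rnorm_lt ?(ltW e0)//; apply: le_lt_trans.
rewrite ger0_norm; last by rewrite sumr_ge0// => *; exact: rnorm_ge0.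
elim/big_rec2 : _ => [|k a b _ ba]; first by rewrite rnorm0.
by rewrite (le_trans (ler_rnormD _ _))// lerD2l.
Qed.

End real_scalars.

(** * Operator norms and norm-attaining operators *)

Section operator_norm.
Context {R : realType} {s : scalar_kind}.
Local Notation F := (scalars R s).
Implicit Types X Y : normedModType F.

Lemma rnorm_le_continuous_linear X Y (T : {linear X -> Y}) (M : R) :
  (forall x, rnorm (T x) <= M * rnorm x) -> continuous T.
Proof.
move=> TM x; apply/cvg_rnormP => e e0.
have M0 : 0 < `|M| + 1 by rewrite ltr_pwDr.
have /cvg_rnormP/(_ (e / (`|M| + 1))) : (id @ nbhs x --> x) by exact: cvg_id.
rewrite divr_gt0// => /(_ isT); apply: filterS => y.
rewrite ltr_pdivlMr// => xy; rewrite -raddfB (le_lt_trans (TM _))//.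
apply: le_lt_trans xy; rewrite mulrC ler_wpM2l ?rnorm_ge0//.
by rewrite (le_trans (ler_norm _))// lerDl.
Qed.

Lemma continuous_linear_rnorm_le X Y (T : {linear X -> Y}) :
  continuous T -> exists M : R, forall x, rnorm (T x) <= M * rnorm x.
Proof.
move=> cT; have /cvg_rnormP/(_ 1 ltr01) := cT 0.
move=> /nbhs_ballP[e /= e0 eT].
pose d := scalar_re e; have de : scalar_of_real d = e by rewrite scalar_reK ?ltW.
have d0 : 0 < d by rewrite -(@lt_scalar_of_real R s) scalar_of_real0 de.
exists (2 / d) => x.
have [/rnorm_eq0 ->|x0] := eqVneq (rnorm x) 0.
  by rewrite linear0 !rnorm0 mulr0.
have xp : 0 < rnorm x by rewrite lt_neqAle eq_sym x0 rnorm_ge0.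
pose c := d / 2 / rnorm x.
have c0 : 0 < c by rewrite !divr_gt0.
have : rnorm (T 0 - T (scalar_of_real c *: x)) < 1.
  apply: eT; rewrite -ball_normE /= rnorm_lt ?(ltW e0)// rnormB subr0 rnormZr.
  by rewrite gtr0_norm// /c divfK// -/d ltr_pdivrMr// ltr_pMr// ltr1n.
rewrite linear0 rnormB subr0 linearZ_LR rnormZr gtr0_norm// => /ltW.
rewrite -ler_pdivlMl// mulr1 => /le_trans; apply.
by rewrite /c !invf_div mulrC.
Qed.

Lemma opnorm_le X Y (f : X -> Y) (M : R) :
  (forall x, rnorm x <= 1 -> rnorm (f x) <= M) -> opnorm f <= M.
Proof.
move=> fM; apply: ge_sup.
  by exists (rnorm (f 0)), 0; rewrite // /unit_ball/= rnorm0.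
by move=> _ [x /= x1 <-]; exact: fM.
Qed.

Lemma opnorm_ge_unit X Y (T : {linear X -> Y}) x : continuous T ->
  rnorm x <= 1 -> rnorm (T x) <= opnorm T.
Proof.
move=> /continuous_linear_rnorm_le[M TM] x1; apply: ub_le_sup; last by exists x.
exists `|M| => _ [y /= y1 <-]; apply: le_trans (TM y) _.
rewrite -[leRHS]mulr1 (le_trans (ler_wpM2r (rnorm_ge0 _) (ler_norm M)))//.
by rewrite ler_wpM2l.
Qed.

Lemma opnorm_ge0 X Y (T : {linear X -> Y}) : continuous T -> 0 <= opnorm T.
Proof.
by move=> cT; rewrite -(@rnorm0 _ _ Y) -(linear0 T) opnorm_ge_unit// rnorm0.
Qed.

Lemma opnorm_ub X Y (T : {linear X -> Y}) x : continuous T ->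
  rnorm (T x) <= opnorm T * rnorm x.
Proof.
move=> cT; have [/rnorm_eq0 ->|x0] := eqVneq (rnorm x) 0.
  by rewrite linear0 !rnorm0 mulr0.
have xp : 0 < rnorm x by rewrite lt_neqAle eq_sym x0 rnorm_ge0.
rewrite -ler_pdivrMr// mulrC.
rewrite -[(rnorm x)^-1]ger0_norm ?invr_ge0 ?rnorm_ge0// -rnormZr -linearZ_LR.
apply: opnorm_ge_unit => //.
by rewrite rnormZr ger0_norm ?invr_ge0 ?rnorm_ge0// mulVf.
Qed.

Lemma sphere_contraction X Y (T : {linear X -> Y}) x :
  operator_sphere X Y T -> rnorm (T x) <= rnorm x.
Proof. by move=> [cT T1]; rewrite -[leRHS]mul1r -T1 opnorm_ub. Qed.

Lemma rnorm_operatorB_le X Y (S T : {linear X -> Y}) (e : R) x :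
  operator_sphere X Y S -> operator_sphere X Y T -> opnorm (S \- T) <= e ->
  rnorm (S x - T x) <= e * rnorm x.
Proof.
move=> [cS _] [cT _] STe.
have cB : continuous (S \- T) by move=> w; apply: cvgB; [exact: cS|exact: cT].
by apply: le_trans (opnorm_ub x cB) _; rewrite ler_wpM2r ?rnorm_ge0.
Qed.

Lemma attaining_sphere X Y (T : {linear X -> Y}) x :
  (forall x, rnorm (T x) <= rnorm x) ->
  rnorm x = 1 -> 1 <= rnorm (T x) -> operator_sphere X Y T.
Proof.
move=> T1 x1 Tx; have cT : continuous T.
  by apply: (@rnorm_le_continuous_linear _ _ _ 1) => y; rewrite mul1r.
split=> //; apply/le_anti/andP; split.
  by apply: opnorm_le => y; apply: le_trans.
by rewrite (le_trans Tx)// opnorm_ge_unit ?x1.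
Qed.

(** Operators are built throughout from a formula for their values; this turns
the formula into a bundled linear map. *)
Lemma linear_pack X Y (f : X -> Y) : linear f ->
  exists T : {linear X -> Y}, forall x, T x = f x.
Proof.
move=> lf.
pose fT := GRing.isLinear.Build F X Y *:%R f lf.
pose T : {linear X -> Y} := HB.pack f fT.
by exists T.
Qed.

(** Dividing [H] by its norm moves [H x] by [(1 / opnorm H - 1) * rnorm (H x)],
and [rnorm (H x) <= opnorm H * rnorm x] cancels the denominator. *)
Lemma rescale_to_sphere X Y (H : {linear X -> Y}) : continuous H ->
  0 < opnorm H <= 1 ->
  exists2 T, operator_sphere X Y T &
    forall x, rnorm (T x - H x) <= (1 - opnorm H) * rnorm x.
Proof.
move=> cH; set a := opnorm H => /andP[a0 a1].
have [T TE] : exists T : {linear X -> Y}, forall x, T x = scalar_of_real a^-1 *: H x.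
  by apply: linear_pack => c x y; rewrite linearP scalerDr !scalerA mulrC.
have Tn x : rnorm (T x) = a^-1 * rnorm (H x).
  by rewrite TE rnormZr ger0_norm// invr_ge0 ltW.
exists T.
  have cT : continuous T.
    apply: (@rnorm_le_continuous_linear _ _ _ 1) => x.
    by rewrite Tn mul1r mulrC ler_pdivrMr// mulrC opnorm_ub.
  split=> //; apply/le_anti/andP; split.
    apply: opnorm_le => x x1.
    by rewrite Tn mulrC ler_pdivrMr// mul1r opnorm_ge_unit.
  rewrite -(ler_pM2l a0) mulr1; apply: opnorm_le => x x1.
  by rewrite -ler_pdivrMl// -Tn opnorm_ge_unit.
move=> x; have -> : T x - H x = scalar_of_real (a^-1 - 1) *: H x.
  by rewrite TE scalar_of_realB scalerBl scalar_of_real1 scale1r.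
have b0 : 0 <= a^-1 - 1 by rewrite subr_ge0 invf_ge1.
rewrite rnormZr ger0_norm//.
apply: le_trans (ler_wpM2l b0 (opnorm_ub x cH)) _.
by rewrite mulrA mulrBl mulVf ?gt_eqF// mul1r.
Qed.

(** The zero operator, which cannot be rescaled, lies at distance exactly 1 from
every operator of the sphere, so the same bound holds for it. *)
Lemma exists_sphere_near X Y (H : {linear X -> Y}) :
  (exists T, operator_sphere X Y T) -> continuous H -> opnorm H <= 1 ->
  exists2 T, operator_sphere X Y T &
    forall x, rnorm (T x - H x) <= (1 - opnorm H) * rnorm x.
Proof.
move=> [D SD] cH H1; have [H0|H0] := eqVneq (opnorm H) 0; last first.
  by apply: rescale_to_sphere; rewrite // lt_neqAle eq_sym H0 opnorm_ge0.
exists D => // x; have -> : H x = 0.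
  apply: rnorm_eq0; apply/le_anti; rewrite rnorm_ge0 andbT.
  by rewrite (le_trans (opnorm_ub _ cH))// H0 mul0r.
by rewrite H0 !subr0 mul1r sphere_contraction.
Qed.

End operator_norm.

(** * Local modification of operators into C(K, Y) *)

Section localization.
Context {R : realType} {s : scalar_kind} {K : topologicalType}.
Context (cK : compact [set: K]) (Y : completeNormedModType (scalars R s)).
Local Notation F := (scalars R s).
Local Notation C := (cfun cK Y).
Implicit Types (E : normedModType F) (t : K).

Lemma rnorm_cfun_ge (f : C) t : rnorm (f t) <= rnorm f.
Proof. by rewrite [leRHS]scalar_of_realK; exact: rnorm_le_cfun_rnorm. Qed.

Lemma rnorm_cfun_le (f : C) (M : R) :
  0 <= M -> (forall t, rnorm (f t) <= M) -> rnorm f <= M.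
Proof. by move=> M0 fM; rewrite [leLHS]scalar_of_realK; exact: cfun_rnorm_le. Qed.

Lemma rnorm_cfun_gt (f : C) (M : R) :
  0 <= M -> M < rnorm f -> exists t, M < rnorm (f t).
Proof.
move=> M0 Mf; apply: contrapT => /forallNP h.
suff : rnorm f <= M by rewrite leNgt Mf.
by apply: rnorm_cfun_le => // t; rewrite leNgt; apply/negP/h.
Qed.

Lemma eval_pack E (T : {linear E -> C}) t :
  exists H : {linear E -> Y}, forall x, H x = T x t.
Proof. by apply: linear_pack => a x y; rewrite linearP. Qed.

Lemma urysohn_bump (t0 : K) (V : set K) : hausdorff_space K -> nbhs t0 V ->
  exists phi : K -> R, [/\ continuous phi, forall t, 0 <= phi t <= 1,
    phi t0 = 1 & forall t, ~ V t -> phi t = 0].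
Proof.
move=> hK V0.
have crK : completely_regular_space K.
  apply: (normal_completely_regular (R := R)).
    exact: compact_normal.
  exact: hausdorff_accessible.
have /(uniform_separatorP (R := R))[f [cf f01 f0 f1]] :
    uniform_separator [set t0] (~` V°).
  apply: crK; first exact/open_closedC/open_interior.
  by apply; exact: nbhs_singleton (nbhs_interior V0).
exists (fun t => 1 - f t); split.
- by move=> t; apply: cvgB; [exact: cvg_cst|exact: cf].
- move=> t; have := f01 (f t) (ex_intro2 _ _ t I erefl).
  by rewrite /= in_itv /= => /andP[f_0 f_1]; rewrite subr_ge0 f_1 lerBlDr lerDl.
- by rewrite (f0 (f t0)) ?subr0//; exists t0.
- move=> t Vt; rewrite (f1 (f t)) ?subrr//; exists t => //.
  by move=> /interior_subset.
Qed.

(** The easy direction of the Arzela-Ascoli theorem: near a fixed [f] the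
condition at [t] follows from the continuity of [f] alone, and compactness makes
the neighbourhood of [t0] uniform in [f]. *)
Lemma compact_operator_equicontinuous E (T : {linear E -> C}) t0 (d : R) :
  compact_operators E C T -> 0 < d ->
  \forall t \near t0, forall x, rnorm (T x t - T x t0) <= d * rnorm x.
Proof.
move=> [_ /compact_near_coveringP cT] d0.
have d30 : 0 < d / 3 by rewrite divr_gt0.
have : \forall t \near t0, closure (T @` unit_ball E) `<=`
    (fun f : C => rnorm (f t - f t0) <= d).
  apply: (cT _ _ (fun t (f : C) => rnorm (f t - f t0) <= d)) => f _.
  have /cvg_rnormP/(_ _ d30) ft : f @ t0 --> f t0 by exact: cfunP.
  have /cvg_rnormP/(_ _ d30) fg : (fun g : C => g) @ nbhs f --> f by exact: cvg_id.
  exists ([set g : C | rnorm ((f : C) - g) < d / 3],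
    [set t | rnorm ((f : C) t0 - (f : C) t) < d / 3]).
    by split.
  move=> [g t] [/= fgd ftd].
  have gd u : rnorm (g u - f u) <= d / 3.
    by rewrite rnormB (le_trans (rnorm_cfun_ge (f - g) u))// ltW.
  have -> : g t - g t0 = (g t - f t) + ((f t - f t0) + (f t0 - g t0)).
    by rewrite [_ + (_ - g t0)]addrA subrK addrA subrK.
  have -> : d = d / 3 + (d / 3 + d / 3) by field.
  rewrite (le_trans (ler_rnormD _ _))// lerD//.
  rewrite (le_trans (ler_rnormD _ _))// lerD//; first by rewrite rnormB ltW.
  by rewrite rnormB.
apply: filterS => t Tt x.
have [/rnorm_eq0 ->|x0] := eqVneq (rnorm x) 0.
  by rewrite linear0 subrr !rnorm0 mulr0.
have xp : 0 < rnorm x by rewrite lt_neqAle eq_sym x0 rnorm_ge0.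
have vp : 0 <= (rnorm x)^-1 by rewrite invr_ge0 ltW.
have : rnorm (T (scalar_of_real (rnorm x)^-1 *: x) t -
              T (scalar_of_real (rnorm x)^-1 *: x) t0) <= d.
  apply: Tt; apply: subset_closure; eexists; last reflexivity.
  by rewrite /unit_ball /= rnormZr ger0_norm// mulVf.
rewrite linearZ_LR -[X in rnorm X]scalerBr rnormZr ger0_norm//.
by rewrite mulrC ler_pdivrMr.
Qed.

Definition Lprojection E (P : {linear E -> E}) :=
  (forall x, P (P x) = P x) /\
  (forall x, rnorm x = rnorm (P x) + rnorm (x - P x)).

(** The operator is
[S x t = T (x - P x) t + ((1 - phi t) T (P x) t + phi t G (P x))] for a Urysohn function [phi] at [t0]. The L-projection identity bounds it by
[rnorm (x - P x) + rnorm (P x) = rnorm x], and [S - T = phi (G - T) P] is only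
felt where [T (P x) t] is close to [T (P x) t0]. With [P] the identity this is
the case of a compact [T]. *)
Lemma localized_perturbation E (T : {linear E -> C}) (G : {linear E -> Y})
    (P : {linear E -> E}) t0 (a d : R) :
  hausdorff_space K -> Lprojection P ->
  (forall x, rnorm (T x) <= rnorm x) -> (forall x, rnorm (G x) <= rnorm x) ->
  0 <= a -> 0 <= d ->
  (forall x, rnorm (G x - T x t0) <= a * rnorm x) ->
  (\forall t \near t0, forall x, rnorm (T (P x) t - T (P x) t0) <= d * rnorm x) ->
  exists S : {linear E -> C}, [/\ forall x, rnorm (S x) <= rnorm x,
    forall x, S (P x) t0 = G (P x) & opnorm (S \- T) <= a + d].
Proof.
move=> hK [PP Pn] T1 G1 a0 d0 GT PT.
have [phi [cphi phi01 phi1 phi0]] := urysohn_bump hK PT.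
(* This form makes linearity and the distance to [T] visible; the convex
   combination above is recovered where contractivity is proved. *)
pose S0 x t : Y := T x t + scalar_of_real (phi t) *: (G (P x) - T (P x) t).
have cS x : S0 x \in continuous_pred.
  apply/asboolP => t; apply: cvgD; first exact: cfunP.
  apply: cvgZ; last by apply: cvgB; [exact: cvg_cst|exact: cfunP].
  apply: (@cvg_comp _ _ _ phi scalar_of_real); first exact: cphi.
  exact: scalar_of_real_continuous.
pose S1 x : C := CFun cK (cS x).
have [S SE] : exists S : {linear E -> C}, forall x, S x = S1 x.
  apply: linear_pack => c x y; apply/val_inj/funext => t.
  change (S0 (c *: x + y) t = c *: S0 x t + S0 y t).
  have fE (f g : C) : (c *: f + g) t = c *: f t + g t by [].
  rewrite /S0 !linearP !fE [c *: G _ + _ + _]addrACA -scalerDr /=.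
  rewrite scalerDr [in RHS]scalerDr scalerA [_ * c]mulrC -scalerA.
  by rewrite addrACA.
have PT1 x : rnorm (P x) <= rnorm x by rewrite [leRHS]Pn lerDl rnorm_ge0.
exists S; split.
- move=> x; rewrite SE; apply: rnorm_cfun_le => [|t]; first exact: rnorm_ge0.
  have /andP[p0 p1] := phi01 t.
  have -> : S1 x t = T (x - P x) t + (scalar_of_real (1 - phi t) *: T (P x) t
                     + scalar_of_real (phi t) *: G (P x)).
    have -> : T (x - P x) t = T x t - T (P x) t by rewrite raddfB.
    rewrite scalar_of_realB scalerBl scalar_of_real1 scale1r.
    by rewrite /= /S0 scalerBr -!addrA addKr [- _ + _]addrC.
  rewrite [leRHS]Pn [leRHS]addrC (le_trans (ler_rnormD _ _))// lerD//.
    by rewrite (le_trans (rnorm_cfun_ge _ _)).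
  rewrite (le_trans (ler_rnormD _ _))// !rnormZr !ger0_norm ?subr_ge0//.
  have -> : rnorm (P x) = (1 - phi t) * rnorm (P x) + phi t * rnorm (P x) by ring.
  rewrite lerD// ler_wpM2l ?subr_ge0//.
  by rewrite (le_trans (rnorm_cfun_ge _ _)).
- move=> x; rewrite SE /= /S0 phi1 scalar_of_real1 scale1r PP.
  by rewrite addrC subrK.
- apply: opnorm_le => x x1; rewrite /= SE.
  apply: rnorm_cfun_le => [|t]; first exact: addr_ge0.
  have -> : (S1 x - T x) t = scalar_of_real (phi t) *: (G (P x) - T (P x) t).
    transitivity (S0 x t - T x t) => //.
    by rewrite /S0 addrC addKr.
  have /andP[p0 p1] := phi01 t.
  have [Vt|/phi0->] := pselect
    (forall x, rnorm (T (P x) t - T (P x) t0) <= d * rnorm x);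
    last by rewrite scalar_of_real0 scale0r rnorm0 addr_ge0.
  rewrite rnormZr ger0_norm//.
  rewrite (le_trans (ler_piMl _ p1)) ?rnorm_ge0//.
  have -> : G (P x) - T (P x) t = (G (P x) - T (P x) t0) - (T (P x) t - T (P x) t0).
    by rewrite opprB addrA subrK.
  rewrite (le_trans (ler_rnormB _ _))// lerD//.
    rewrite (le_trans (GT _))// ler_piMr// (le_trans (PT1 _))//.
  by rewrite (le_trans (Vt _))// ler_piMr.
Qed.

End localization.

(** * Convex series of vectors *)

Section convex_combinations.
Context {R : realType} {s : scalar_kind}.
Local Notation F := (scalars R s).
Local Notation combination alpha v :=
  (series (fun k => scalar_of_real (alpha k) *: v k)).
Implicit Types (alpha a : nat -> R) (V : completeNormedModType F).

Lemma convex_series_cvg V alpha (v : nat -> V) : convex_series alpha ->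
  (forall k, rnorm (v k) <= 1) -> cvgn (combination alpha v).
Proof.
move=> [al0 al1] v1; apply: rnorm_cvg_series.
apply: (@series_le_cvg _ _ alpha) => [k||k|].
- exact: rnorm_ge0.
- exact: al0.
- by rewrite rnormZr ger0_norm// ler_piMr.
- by apply/cvg_ex; exists 1.
Qed.

Lemma rnorm_combination_le V alpha a (v : nat -> V) n :
  (forall k, 0 <= alpha k) -> (forall k, rnorm (v k) <= a k) ->
  rnorm (combination alpha v n) <= \sum_(0 <= k < n) alpha k * a k.
Proof.
move=> al0 va; rewrite /series /=.
elim/big_rec2 : _ => [|k x y _ yx]; first by rewrite rnorm0.
rewrite (le_trans (ler_rnormD _ _))// lerD//.
by rewrite rnormZr ger0_norm// ler_wpM2l.
Qed.

(** The partial sums of [alpha k * (1 - a k)] increase to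
[1 - \sum_k alpha k * a k], and the subtracted sum dominates the norm of the
combination, which exceeds [1 - e]. *)
Lemma convex_series_slack V alpha a (v : nat -> V) (e : R) n :
  convex_series alpha -> (forall k, a k <= 1) ->
  (forall k, rnorm (v k) <= a k) ->
  1 - e < rnorm (limn (combination alpha v)) ->
  \sum_(0 <= k < n) alpha k * (1 - a k) <= e.
Proof.
move=> ca a1 va hlim; have [al0 al1] := ca.
have cv : combination alpha v @ \oo --> limn (combination alpha v).
  by apply: convex_series_cvg => // k; exact: le_trans (va k) (a1 k).
apply: (@le_trans _ _ (1 - rnorm (limn (combination alpha v)))); last first.
  by rewrite lerBlDr -lerBlDl ltW.
have cc : (fun m => series alpha m - rnorm (combination alpha v m)) @ \oo -->
    1 - rnorm (limn (combination alpha v)).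
  by apply: cvgB => //; exact: cvg_rnorm.
apply: (cvgr_to_ge cc); near=> m.
apply: (@le_trans _ _ (\sum_(0 <= k < m) alpha k * (1 - a k))).
  have nm : (n <= m)%N by near: m; exact: nbhs_infty_ge.
  rewrite (big_cat_nat (n := n) (p := m))//= lerDl sumr_ge0// => k _.
  by rewrite mulr_ge0// subr_ge0.
rewrite lerBrDr -lerBrDl [X in _ <= X - _]/series /= -sumrB.
apply: le_trans (rnorm_combination_le m al0 va) _.
by apply: ler_sum => k _; rewrite mulrBr mulr1 opprB addrC subrK.
Unshelve. all: by end_near. Qed.

Lemma rnorm_lim_combinationB_le V alpha a (v w : nat -> V) (e : R) :
  (forall k, 0 <= alpha k) -> cvgn (combination alpha v) ->
  cvgn (combination alpha w) -> (forall k, rnorm (v k - w k) <= a k) ->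
  (forall n, \sum_(0 <= k < n) alpha k * a k <= e) ->
  rnorm (limn (combination alpha v) - limn (combination alpha w)) <= e.
Proof.
move=> al0 cv cw vw ae.
have cc : (fun m => rnorm (combination alpha v m - combination alpha w m)) @ \oo -->
    rnorm (limn (combination alpha v) - limn (combination alpha w)).
  by apply: cvg_rnorm; apply: cvgB.
apply: (cvgr_to_le cc); apply: nearW => n.
have ->  : combination alpha v n - combination alpha w n =
    combination alpha (fun k => v k - w k) n.
  by rewrite /series /= -sumrB; apply: eq_bigr => k _; rewrite scalerBr.
exact: le_trans (rnorm_combination_le n al0 vw) (ae n).
Qed.

Lemma esum_le_partial_sums (u : nat -> R) (D : set nat) (M : R) :
  (forall k, 0 <= u k) -> (forall n, \sum_(0 <= k < n) u k <= M) ->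
  (\esum_(k in D) (u k)%:E <= M%:E)%E.
Proof.
move=> u0 uM; rewrite esum_mkcond.
apply: (@le_trans _ _ (\esum_(k in [set: nat]) (u k)%:E)%E).
  by apply: le_esum => k _; case: ifP => _; rewrite lee_fin.
rewrite -nneseries_esumT; last by move=> k; rewrite lee_fin.
apply: lime_le; first by apply: is_cvg_nneseries => k _ _; rewrite lee_fin.
by apply: nearW => n; rewrite sumEFin lee_fin.
Qed.

(** Chebyshev's inequality: an index [k] where [a] falls short of 1 by more than
[d] contributes at least [d * alpha k] to a total of at most [d * d]. *)
Lemma esum_small_deficit alpha a (A : set nat) (d : R) :
  0 < d -> (forall k, 0 <= alpha k) -> (forall k, a k <= 1) ->
  (forall n, \sum_(0 <= k < n) alpha k * (1 - a k) <= d * d) ->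
  ((1 - d)%:E < \esum_(k in A) (alpha k)%:E)%E ->
  ((1 - (d + d))%:E <
    \esum_(k in A `&` [set k | (1 - a k <= d)%R]) (alpha k)%:E)%E.
Proof.
move=> d0 al0 a1 ad; apply: contraTT; rewrite -!leNgt => hA.
rewrite (esumID [set k | (1 - a k <= d)%R]); last by move=> k _; rewrite lee_fin.
rewrite (_ : 1 - d = 1 - (d + d) + d); last by ring.
rewrite EFinD; apply: leeD hA _.
apply: (@le_trans _ _ (\esum_(k in A `&` ~` [set k | (1 - a k <= d)%R])
    (d^-1 * (alpha k * (1 - a k)))%:E)%E).
  apply: le_esum => k [_ /negP]; rewrite -ltNge => dk.
  rewrite lee_fin mulrCA ler_peMr// ler_pdivlMl// mulr1 ltW//.
apply: esum_le_partial_sums => [k|n].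
  by rewrite !mulr_ge0// ?subr_ge0// invr_ge0 ltW.
by rewrite -mulr_sumr ler_pdivrMl.
Qed.

End convex_combinations.

(** * The generalized AHSP for C(K, Y) *)

Section AHSP_of_cfun.
Context {R : realType} {s : scalar_kind} {K : topologicalType}.
Context (cK : compact [set: K]) (X Y : completeNormedModType (scalars R s)).
Local Notation F := (scalars R s).
Local Notation C := (cfun cK Y).

Lemma lim_series_cfun (v : nat -> C) t : cvgn (series v) ->
  limn (series (fun k => v k t)) = (limn (series v)) t.
Proof.
move=> cv; apply: cvg_lim; first exact: norm_hausdorff.
have E n : series (fun k => v k t) n = (series v n) t.
  rewrite /series /=; elim: n => [|n IH]; first by rewrite !big_geq.
  by rewrite !big_nat_recr//= IH.
apply/cvg_rnormP => e e0; have /cvg_rnormP/(_ _ e0) := cv.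
apply: filterS => n; apply: le_lt_trans; rewrite E.
exact: (rnorm_cfun_ge (limn (series v) - series v n) t).
Qed.

(** Composing [y] with the evaluation at [t] cannot increase the norm; the
value at [f] shows that it does not decrease either. *)
Lemma evaluation_norming (y : {linear Y -> F^o}) (t : K) (f : C) :
  operator_sphere Y F^o y -> rnorm f <= 1 -> y (f t) = 1 ->
  exists2 y' : {linear C -> F^o}, operator_sphere C F^o y' &
    forall g, y' g = y (g t).
Proof.
move=> Sy f1 yf.
have [y' y'E] : exists y' : {linear C -> F^o}, forall g, y' g = y (g t).
  by apply: linear_pack => c g h; rewrite -linearP.
exists y' => //.
have y'1 g : rnorm (y' g) <= rnorm g.
  by rewrite y'E (le_trans (sphere_contraction _ Sy))// rnorm_cfun_ge.
have n1 : rnorm (1 : F^o) = 1 by rewrite /rnorm normr1 scalar_re1.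
apply: (attaining_sphere (x := f)) => //; last by rewrite y'E yf n1.
by apply/le_anti; rewrite f1 (le_trans _ (y'1 f))// y'E yf n1.
Qed.

Lemma generalized_AHSP_cfun : hausdorff_space K -> generalized_AHSP X Y ->
  bounded_operators X C = compact_operators X C -> generalized_AHSP X C.
Proof.
move=> hK hXY hcomp eps eps0.
(* Three errors of size [d] add up in the perturbation of [T]; the bound by 1/6
   also keeps [1 - (d + d)] positive, hence the index set nonempty. *)
pose d := Num.min eps 1 / 6.
have m0 : 0 < Num.min eps 1 by rewrite lt_min eps0 ltr01.
have d0 : 0 < d by rewrite divr_gt0.
have d6 : 6 * d <= eps by rewrite /d mulrC divfK// ge_min lexx.
have d61 : 6 * d <= 1 by rewrite /d mulrC divfK// ge_min lexx orbT.
have [eta1 /andP[eta10 eta1d] hd] := hXY d d0.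
(* Half of [eta1] is the deficit allowed in the hypothesis, half the loss in
   moving onto the sphere; the Chebyshev estimate with threshold [d] needs a
   total deficit of at most [d * d]. *)
pose eta := Num.min (eta1 / 2) (d * d).
have eta0 : 0 < eta by rewrite lt_min divr_gt0// mulr_gt0.
have eta2 : eta <= eta1 / 2 by rewrite ge_min lexx.
have etad : eta <= d * d by rewrite ge_min lexx orbT.
exists eta; first by rewrite eta0 /=; lra.
move=> T x alpha ST Sx ca hlim; have [al0 _] := ca.
have T1 k y : rnorm (T k y) <= rnorm y by exact: sphere_contraction.
have cv : cvgn (series (fun k => scalar_of_real (alpha k) *: T k (x k))).
  by apply: convex_series_cvg => // k; rewrite (le_trans (T1 _ _))// Sx.
have [t0 ht0] : exists t, 1 - eta <
    rnorm ((limn (series (fun k => scalar_of_real (alpha k) *: T k (x k)))) t).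
  by apply: rnorm_cfun_gt => //; lra.
have [H HE] := choice (fun k => eval_pack (T k) t0).
have H1 k y : rnorm (H k y) <= rnorm y.
  by rewrite HE (le_trans (rnorm_cfun_ge _ _)).
have cH k : continuous (H k).
  by apply: (@rnorm_le_continuous_linear _ _ _ _ _ 1) => y; rewrite mul1r.
pose a k := opnorm (H k).
have a1 k : a k <= 1 by apply: opnorm_le => y; exact: le_trans.
have Hx k : rnorm (H k (x k)) <= a k by rewrite opnorm_ge_unit// Sx.
have hlimH : 1 - eta <
    rnorm (limn (series (fun k => scalar_of_real (alpha k) *: H k (x k)))).
  rewrite -lim_series_cfun// in ht0; move: ht0; congr (_ < rnorm (limn (series _))).
  by apply/funext => k; rewrite HE.
have slack n : \sum_(0 <= k < n) alpha k * (1 - a k) <= eta.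
  exact: (convex_series_slack n ca a1 Hx hlimH).
(* Were every [H k] zero, the evaluated series would vanish; so the unit sphere
   of operators is nonempty, as replacing the vanishing [H k] requires. *)
have sphereXY : exists G, operator_sphere X Y G.
  apply: contrapT => nS.
  have H0 k : H k (x k) = 0.
    apply: rnorm_eq0; apply/le_anti; rewrite rnorm_ge0 andbT (le_trans (Hx k))//.
    rewrite leNgt; apply/negP => ak0; apply: nS.
    by have [|G SG _] := rescale_to_sphere (cH k); [rewrite [0 < _]ak0 a1|exists G].
  move: hlimH; rewrite (_ : series _ = cst 0); last first.
    by apply/funext => n; rewrite /series /= big1// => k _; rewrite H0 scaler0.
  rewrite lim_cst; last exact: norm_hausdorff.
  by rewrite rnorm0; lra.
have [H' SH' HH'] : exists2 H' : nat -> {linear X -> Y},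
    forall k, operator_sphere X Y (H' k) &
    forall k y, rnorm (H' k y - H k y) <= (1 - a k) * rnorm y.
  have /choice[H' H'P] : forall k, exists G, operator_sphere X Y G /\
      forall y, rnorm (G y - H k y) <= (1 - a k) * rnorm y.
    by move=> k; have [G SG HG] := exists_sphere_near sphereXY (cH k) (a1 k); exists G.
  by exists H' => k; have [] := H'P k.
have hlimH' : 1 - eta1 <
    rnorm (limn (series (fun k => scalar_of_real (alpha k) *: H' k (x k)))).
  have cH' : cvgn (series (fun k => scalar_of_real (alpha k) *: H' k (x k))).
    by apply: convex_series_cvg => // k; rewrite (le_trans (sphere_contraction _ (SH' k)))// Sx.
  have cHx : cvgn (series (fun k => scalar_of_real (alpha k) *: H k (x k))).
    by apply: convex_series_cvg => // k; rewrite (le_trans (Hx k)).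
  have := rnorm_lim_combinationB_le (a := fun k => 1 - a k) al0 cHx cH' _ slack.
  set u := limn _ in hlimH *; set v := limn _ => huv.
  have {huv}: rnorm (u - v) <= eta.
    apply: huv => k; rewrite rnormB (le_trans (HH' k _))//.
    by rewrite (Sx k) mulr1.
  by have := rnorm_le_dist u v; lra.
have [A1 [y [G [z [Sy SGz hA1 Gz yGz]]]]] := hd _ _ _ SH' Sx ca hlimH'.
pose A := A1 `&` [set k | 1 - a k <= d].
have hA : ((1 - (d + d))%:E < \esum_(k in A) (alpha k)%:E)%E.
  by apply: esum_small_deficit => // n; rewrite (le_trans (slack n)).
have [k0 Ak0] : exists k, A k.
  apply: contrapT => nA; move: hA.
  have -> : A = set0 by rewrite -subset0 => k Ak; apply: nA; exists k.
  rewrite esum_set0 lte_fin; lra.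
have perturbation k : A k -> exists S : {linear X -> C},
    [/\ operator_sphere X C S, S (z k) t0 = G k (z k) & opnorm (S \- T k) < eps].
  move=> [A1k /= ak]; have [SG Sz] := SGz k; have [zx GH] := Gz k A1k.
  have cmp : compact_operators X C (T k) by rewrite -hcomp; case: (ST k).
  have idP : Lprojection (idfun : {linear X -> X}).
    by split=> // u; rewrite /= subrr rnorm0 addr0.
  have [|||||S [S1 St0 STk]] := @localized_perturbation _ _ _ cK Y _ (T k) (G k)
      (idfun : {linear X -> X}) t0 (d + d) d hK idP (T1 k).
  - by move=> u; exact: sphere_contraction.
  - by rewrite addr_ge0// ltW.
  - exact: ltW.
  - move=> u; rewrite -HE.
    rewrite (_ : G k u - H k u = (G k u - H' k u) + (H' k u - H k u)); last first.
      by rewrite addrA subrK.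
    rewrite (le_trans (ler_rnormD _ _))// mulrDl lerD//.
      by apply: rnorm_operatorB_le => //; exact: ltW.
    by rewrite (le_trans (HH' k u))// ler_wpM2r ?rnorm_ge0.
  - exact: compact_operator_equicontinuous.
  exists S; split; [|exact: (St0 (z k))|by apply: le_lt_trans STk _; lra].
  apply: (attaining_sphere (x := z k)) => //.
  apply: le_trans (rnorm_cfun_ge (S (z k)) t0).
  rewrite St0 -(@scalar_re1 R s) -normr1 -(yGz k A1k).
  exact: (sphere_contraction (G k (z k)) Sy).
have perturbed : forall k, exists p : {linear X -> C} * X,
    [/\ operator_sphere X C p.1, unit_sphere X p.2 &
      A k -> [/\ p.1 p.2 t0 = G k (z k), rnorm (p.2 - x k) < eps &
                 opnorm (p.1 \- T k) < eps]].
  move=> k; have [Ak|nAk] := pselect (A k); last first.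
    (* Off [A] nothing is required beyond lying on the spheres. *)
    by exists (T k, x k); split=> //=.
  have [S [SS St0 STk]] := perturbation k Ak; have [_ Szk] := SGz k.
  exists (S, z k); split=> // _; split=> //.
  have [zx _] := Gz k Ak.1; apply: lt_le_trans zx _; lra.
have [Sz SzP] := choice perturbed.
have yS k : A k -> y ((Sz k).1 (Sz k).2 t0) = 1.
  by move=> Ak; have [_ _ /(_ Ak)[-> _ _]] := SzP k; exact: yGz Ak.1.
have [S0 z0 _] := SzP k0.
have [|y' Sy' y'E] := evaluation_norming Sy _ (yS k0 Ak0).
  by rewrite (le_trans (sphere_contraction _ S0))// z0.
exists A, y', (fun k => (Sz k).1), (fun k => (Sz k).2); split => //.
- by move=> k; have [] := SzP k.
- by apply: le_lt_trans hA; rewrite lee_fin; lra.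
- by move=> k Ak; have [_ _ /(_ Ak)[]] := SzP k.
- by move=> k Ak; rewrite y'E yS.
Qed.

End AHSP_of_cfun.

(** * Truncations in l1(X) *)

Section l1_truncation.
Context {R : realType} {s : scalar_kind} (X : completeNormedModType (scalars R s)).
Local Notation F := (scalars R s).
Implicit Types (x : l1 X) (N : nat).

Fact l1_trunc_summable N x :
  (fun k => if (k < N)%N then x k else 0) \in @Defs.summable R s X.
Proof.
apply/summableP; exists (l1_rnorm x) => n; apply: le_trans (sum_le_l1_rnorm x n).
by apply: ler_sum => k _; case: ifP => // _; rewrite rnorm0 rnorm_ge0.
Qed.

Definition l1_trunc N x : l1 X := L1 (l1_trunc_summable N x).

Fact l1_trunc_linear N : linear (l1_trunc N).
Proof.
move=> a x y; apply/val_inj/funext => k /=.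
change ((if (k < N)%N then a *: x k + y k else 0) =
  a *: (if (k < N)%N then x k else 0) + (if (k < N)%N then y k else 0)).
by case: ifP => // _; rewrite scaler0 addr0.
Qed.

HB.instance Definition _ N :=
  GRing.isLinear.Build F (l1 X) (l1 X) *:%R (l1_trunc N) (l1_trunc_linear N).

Fact l1_single_summable N (y : X) :
  (fun k => if k == N then y else 0) \in @Defs.summable R s X.
Proof.
apply/summableP; exists (rnorm y) => n.
under eq_bigr do rewrite (fun_if rnorm) rnorm0.
by rewrite -big_mkcond big_nat1_eq; case: ifP => // _; exact: rnorm_ge0.
Qed.

Definition l1_single N (y : X) : l1 X := L1 (l1_single_summable N y).

Fact l1_single_linear N : linear (l1_single N).
Proof.
move=> a x y; apply/val_inj/funext => k /=.
change ((if k == N then a *: x + y else 0) =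
  a *: (if k == N then x else 0) + (if k == N then y else 0)).
by case: ifP => // _; rewrite scaler0 addr0.
Qed.

HB.instance Definition _ N :=
  GRing.isLinear.Build F X (l1 X) *:%R (l1_single N) (l1_single_linear N).

Lemma rnorm_l1_single N (y : X) : rnorm (l1_single N y) <= rnorm y.
Proof.
rewrite [leLHS]scalar_of_realK; apply: l1_rnorm_le => n /=.
under eq_bigr do rewrite (fun_if rnorm) rnorm0.
by rewrite -big_mkcond big_nat1_eq; case: ifP => // _; exact: rnorm_ge0.
Qed.

Lemma l1_trunc0 x : l1_trunc 0 x = 0.
Proof. by apply/val_inj/funext. Qed.

Lemma l1_truncS N x : l1_trunc N.+1 x = l1_trunc N x + l1_single N (x N).
Proof.
apply/val_inj/funext => k.
change ((if (k < N.+1)%N then x k else 0) =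
  (if (k < N)%N then x k else 0) + (if k == N then x N else 0)).
rewrite ltnS leq_eqVlt; have [->|kN] := eqVneq k N; first by rewrite ltnn add0r.
by rewrite addr0.
Qed.

Lemma l1_trunc_Lprojection N : Lprojection (l1_trunc N).
Proof.
split=> [x|x].
  apply/val_inj/funext => k.
  change ((if (k < N)%N then (if (k < N)%N then x k else 0) else 0) =
    (if (k < N)%N then x k else 0)).
  by case: ifP => // ->.
have E k : rnorm (x k) = rnorm (l1_trunc N x k) + rnorm ((x - l1_trunc N x) k).
  change (rnorm (x k) = rnorm (if (k < N)%N then x k else 0) +
    rnorm (x k - (if (k < N)%N then x k else 0))).
  by case: ifP => _; rewrite ?subrr ?subr0 rnorm0 ?addr0 ?add0r.
rewrite !rnorm_l1E; apply: cvg_lim; first exact: norm_hausdorff.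
rewrite (_ : series _ = fun n => series (fun k => rnorm (l1_trunc N x k)) n +
    series (fun k => rnorm ((x - l1_trunc N x) k)) n); last first.
  apply/funext => n; rewrite /series /= -big_split.
  by apply: eq_bigr => k _; rewrite E.
by apply: cvgD; exact: l1_cvg.
Qed.

(** By the L-projection identity the tail is [rnorm x - rnorm (P x)], and
[rnorm (P x)] dominates the partial sum of the norms of [x]. *)
Lemma l1_tail_small x (e : R) : 0 < e -> exists N, rnorm (x - l1_trunc N x) < e.
Proof.
move=> e0; have /cvgrPdist_lt/(_ e e0)[N _ hN] := l1_cvg (x := x).
exists N; have [_ /(_ x) hx] := l1_trunc_Lprojection N.
have {hN} := hN N (leqnn N); rewrite -rnorm_l1E => /(le_lt_trans (ler_norm _)).
apply: le_lt_trans; rewrite lerBrDr hx addrC lerD2r.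
apply: le_trans (_ : \sum_(0 <= k < N) rnorm (l1_trunc N x k) <= _).
  rewrite /series /= !big_nat; apply: ler_sum => k /andP[_ kN].
  by rewrite kN.
by rewrite [leRHS]scalar_of_realK; exact: sum_le_l1_rnorm.
Qed.

End l1_truncation.

(** * The BPBp for operators from l1(X) into C(K, Y) *)

Section BPBp_of_cfun.
Context {R : realType} {s : scalar_kind} {K : topologicalType}.
Context (cK : compact [set: K]) (X Y : completeNormedModType (scalars R s)).
Local Notation F := (scalars R s).
Local Notation C := (cfun cK Y).

(** [T] itself may fail to be compact, but its finitely many coordinates involved
in the truncation are compact operators on [X]; their moduli of continuity at
[t0] add up with the weights [rnorm (x k)]. *)
Lemma l1_trunc_equicontinuous (T : {linear l1 X -> C}) t0 N (d : R) :
  bounded_operators X C = compact_operators X C -> continuous T -> 0 < d ->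
  \forall t \near t0, forall x : l1 X,
    rnorm (T (l1_trunc N x) t - T (l1_trunc N x) t0) <= d * rnorm x.
Proof.
move=> hcomp cT d0.
(* The weighted bound, unlike the one by [rnorm x], is inductive in [N]. *)
suff : \forall t \near t0, forall x : l1 X,
    rnorm (T (l1_trunc N x) t - T (l1_trunc N x) t0) <=
    d * \sum_(0 <= k < N) rnorm (x k).
  apply: filterS => t Tt x; apply: le_trans (Tt x) _.
  rewrite ler_wpM2l ?(ltW d0)// [leRHS]scalar_of_realK.
  exact: sum_le_l1_rnorm.
elim: N => [|N IH].
  by apply: nearW => t x; rewrite l1_trunc0 linear0 subrr rnorm0 big_geq// mulr0.
have cmp : compact_operators X C (T \o l1_single N).
  rewrite -hcomp; have [M TM] := continuous_linear_rnorm_le cT.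
  apply: (@rnorm_le_continuous_linear _ _ _ _ _ `|M|) => y /=.
  rewrite (le_trans (TM _))// (le_trans (ler_wpM2r (rnorm_ge0 _) (ler_norm M)))//.
  by rewrite ler_wpM2l// rnorm_l1_single.
apply: filterS2 IH (compact_operator_equicontinuous t0 cmp d0) => t IH Tt x.
rewrite l1_truncS raddfD big_nat_recr//= mulrDr.
change (rnorm ((T (l1_trunc N x) t + T (l1_single N (x N)) t) -
  (T (l1_trunc N x) t0 + T (l1_single N (x N)) t0)) <=
  d * \sum_(0 <= k < N) rnorm (x k) + d * rnorm (x N)).
by rewrite opprD addrACA (le_trans (ler_rnormD _ _))// lerD ?IH ?Tt.
Qed.

(** A strict loss [rnorm (G (P u)) < rnorm (P u)] could not be compensated on
[u - P u], since the norms of the two parts of [u] add up to that of [u]. *)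
Lemma attains_Lprojection (E V : normedModType F) (G : {linear E -> V})
    (P : {linear E -> E}) u : Lprojection P ->
  (forall x, rnorm (G x) <= rnorm x) -> rnorm u <= rnorm (G u) ->
  rnorm (G (P u)) = rnorm (P u).
Proof.
move=> [_ Pu] G1 Gu; apply/le_anti; rewrite G1 /=.
have := ler_rnormD (G (P u)) (G (u - P u)); rewrite -raddfD addrC subrK.
have := G1 (u - P u); have := Pu u; lra.
Qed.

Lemma BPBp_l1_cfun : hausdorff_space K -> BPBp (l1 X) Y ->
  bounded_operators X C = compact_operators X C -> BPBp (l1 X) C.
Proof.
move=> hK hXY hcomp eps eps0.
(* Three errors of size [d] add up in the perturbation of [T], five in that of
   [x0]; the bound by 1/6 also keeps [P u0] away from zero. *)
pose d := Num.min eps 1 / 6.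
have m0 : 0 < Num.min eps 1 by rewrite lt_min eps0 ltr01.
have d0 : 0 < d by rewrite divr_gt0.
have d6 : 6 * d <= eps by rewrite /d mulrC divfK// ge_min lexx.
have d61 : 6 * d <= 1 by rewrite /d mulrC divfK// ge_min lexx orbT.
have [eta1 eta10 hd] := hXY d d0.
(* Half of [eta1] is the deficit allowed in the hypothesis, half the loss in
   rescaling; [eta <= d] keeps the rescaled operator [d]-close to [H]. *)
pose eta := Num.min (eta1 / 2) d.
have eta0 : 0 < eta by rewrite lt_min divr_gt0.
have eta2 : eta <= eta1 / 2 by rewrite ge_min lexx.
have etad : eta <= d by rewrite ge_min lexx orbT.
exists eta => // T x0 ST Sx0 Tx0.
have T1 x : rnorm (T x) <= rnorm x by exact: sphere_contraction.
have [t0 ht0] : exists t, 1 - eta < rnorm (T x0 t) by apply: rnorm_cfun_gt => //; lra.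
have [H HE] := eval_pack T t0.
have H1 x : rnorm (H x) <= rnorm x by rewrite HE (le_trans (rnorm_cfun_ge _ _)).
have cH : continuous H.
  by apply: (@rnorm_le_continuous_linear _ _ _ _ _ 1) => x; rewrite mul1r.
have nH : 1 - eta < opnorm H.
  by rewrite (lt_le_trans ht0)// -HE opnorm_ge_unit// Sx0.
have [|H' SH' HH'] := rescale_to_sphere cH.
  apply/andP; split; first lra.
  by apply: opnorm_le => x; exact: le_trans.
have H'x0 : 1 - eta1 < rnorm (H' x0).
  have := HH' x0; rewrite Sx0 mulr1 rnormB.
  by have := rnorm_le_dist (H x0) (H' x0); rewrite -HE in ht0; lra.
have [G [u0 [SG Su0 Gu0 ux GH']]] := hd _ _ SH' Sx0 H'x0.
have GH x : rnorm (G x - T x t0) <= (d + d) * rnorm x.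
  rewrite -HE (_ : G x - H x = (G x - H' x) + (H' x - H x)); last first.
    by rewrite addrA subrK.
  rewrite (le_trans (ler_rnormD _ _))// mulrDl lerD//.
    by apply: rnorm_operatorB_le => //; exact: ltW.
  rewrite (le_trans (HH' x))// ler_wpM2r ?rnorm_ge0//; lra.
have [N x0N] := l1_tail_small x0 d0.
have LP := l1_trunc_Lprojection X N; set P := l1_trunc N in x0N LP.
have [PP Pn] := LP.
have [cT _] := ST.
have [||S [S1 St0 STd]] := localized_perturbation hK LP T1 _ _ (ltW d0) GH
    (l1_trunc_equicontinuous t0 N hcomp cT d0).
- by move=> x; exact: sphere_contraction.
- by rewrite addr_ge0// ltW.
have G1 x : rnorm (G x) <= rnorm x by exact: sphere_contraction.
have GP : rnorm (G (P u0)) = rnorm (P u0).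
  by apply: attains_Lprojection => //; rewrite Gu0 Su0.
have tail : rnorm (u0 - P u0) <= d + d.
  have -> : u0 - P u0 = (x0 - P x0) + ((u0 - x0) - P (u0 - x0)).
    have -> : P (u0 - x0) = P u0 - P x0 by exact: (raddfB (l1_trunc N)).
    rewrite opprB [u0 - x0 + _]addrC [P x0 - P u0 + _]addrACA [- P u0 + _]addrC.
    by rewrite [P x0 + u0 + _]addrACA -[x0 - P x0]opprB addKr.
  rewrite (le_trans (ler_rnormD _ _))// lerD// ltW//.
  by apply: le_lt_trans ux; rewrite [leRHS]Pn lerDr rnorm_ge0.
set p := rnorm (P u0) in GP.
have p1 : 1 = p + rnorm (u0 - P u0) by rewrite -Pn Su0.
have p0 : 0 < p by lra.
have p_le1 : p <= 1 by rewrite p1 lerDl rnorm_ge0.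
have p'0 : 0 < p^-1 by rewrite invr_gt0.
pose v : l1 X := scalar_of_real p^-1 *: P u0.
have v1 : rnorm v = 1 by rewrite rnormZr gtr0_norm// mulVf ?gt_eqF.
have Sv : 1 <= rnorm (S v).
  apply: le_trans (rnorm_cfun_ge (S v) t0).
  have -> : S v t0 = scalar_of_real p^-1 *: G (P u0).
    rewrite -St0 /v linearZ_LR //.
  by rewrite rnormZr gtr0_norm// GP mulVf ?gt_eqF.
have SS : operator_sphere (l1 X) C S by exact: attaining_sphere Sv.
exists S, v; split => //.
- by apply/le_anti; rewrite Sv -v1 S1.
- have -> : v - x0 = (v - P u0) + ((P u0 - u0) + (u0 - x0)).
    by rewrite [_ + (_ - x0)]addrA subrK addrA subrK.
  have vP : rnorm (v - P u0) = 1 - p.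
    have -> : v - P u0 = scalar_of_real (p^-1 - 1) *: P u0.
      by rewrite scalar_of_realB scalerBl scalar_of_real1 scale1r.
    rewrite rnormZr ger0_norm; last by rewrite subr_ge0 invf_ge1.
    by rewrite -/p mulrBl mulVf ?gt_eqF// mul1r.
  apply: le_lt_trans (ler_rnormD _ _) _; rewrite vP.
  have := ler_rnormD (P u0 - u0) (u0 - x0); rewrite (rnormB (P u0)); lra.
- apply: le_lt_trans STd _; lra.
Qed.

End BPBp_of_cfun.

Theorem theorem2p2 (R : realType) (s : scalar_kind)
    (X Y : completeNormedModType (scalars R s))
    (K : topologicalType) (cK : compact [set: K]) (hK : hausdorff_space K) :
  (generalized_AHSP X Y ->
   bounded_operators X (cfun cK Y) = compact_operators X (cfun cK Y) ->
   generalized_AHSP X (cfun cK Y)) /\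
  (BPBp (l1 X) Y ->
   bounded_operators X (cfun cK Y) = compact_operators X (cfun cK Y) ->
   BPBp (l1 X) (cfun cK Y)).
Proof. by split; [exact: generalized_AHSP_cfun|exact: BPBp_l1_cfun]. Qed.
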